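(* Let $\mathcal{H}$ be a separable Hilbert space, $\{e_n\}_{n\in\mathbb{N}}$ an orthonormal basis of $\mathcal{H}$ and $T\in L(\mathcal{H})$ surjective. Then $\{Te_n\}_{n\in\mathbb{N}}$ is a Riesz frame if and only if $N(T)$ is compatible with respect to the basis $\{e_n\}_{n\in\mathbb{N}}$.
   Context: A sequence $\{\xi_n\}$ in a Hilbert space $\mathcal{K}$ is a frame of $\mathcal{K}$ if there are constants $A,B>0$ with $A\|\xi\|^2\le\sum_n|\langle\xi,\xi_n\rangle|^2\le B\|\xi\|^2$ for all $\xi\in\mathcal{K}$. A frame $\{\xi_n\}_{n\in\mathbb{N}}$ of $\mathcal{H}$ is a Riesz frame if there exists $C>0$ such that for every $J\subseteq\mathbb{N}$, $\{\xi_n\}_{n\in J}$ is a frame of the closed span $\overline{\mathrm{span}}\{\xi_n:n\in J\}$ with a lower frame constant $A_J\ge C$. $N(T)$ is the nullspace of $T$. Let $\mathcal{D}$ be the algebra of bounded operators diagonal with respect to $\{e_n\}$ and $\mathcal{P}(\mathcal{D})$ its orthogonal projections; for closed subspaces $c[\mathcal{M},\mathcal{N}]=\sup\{|\langle\xi,\eta\rangle|:\xi\in\mathcal{M}\ominus(\mathcal{M}\cap\mathcal{N}),\ \eta\in\mathcal{N}\ominus(\mathcal{M}\cap\mathcal{N}),\ \|\xi\|=\|\eta\|=1\}$. A closed subspace $\mathcal{S}$ is compatible with respect to the basis if $\sup_{Q\in\mathcal{P}(\mathcal{D})}c[\mathcal{S},R(Q)]<1$. *)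

(* Defs.v *)
From mathcomp Require Import all_boot all_order all_algebra.
From mathcomp Require Import complex.
From mathcomp Require Import all_classical all_reals.
From mathcomp Require Import ereal sequences.
Set Implicit Arguments. Unset Strict Implicit. Unset Printing Implicit Defensive.
Import Order.TTheory GRing.Theory Num.Theory.
Local Open Scope ring_scope.
Local Open Scope classical_set_scope.

Section Hilbert.
Variables (R : realType) (V : lmodType R[i]) (ip : V -> V -> R[i]).

Definition abs2 (z : R[i]) : R := complex.Re z ^+ 2 + complex.Im z ^+ 2.
Definition cabs (z : R[i]) : R := Num.sqrt (abs2 z).

Definition hnorm (x : V) : R := Num.sqrt (complex.Re (ip x x)).

Record hilbert_space : Prop := HilbertSpace {
  ip_linear : forall (a : R[i]) (x y z : V), ip (a *: x + y) z = a * ip x z + ip y z;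
  ip_conj : forall x y : V, ip y x = conjc (ip x y);
  ip_pos : forall x : V, 0 <= complex.Re (ip x x);
  ip_def : forall x : V, ip x x = 0 -> x = 0;
  ip_complete : forall u : nat -> V,
    (forall eps : R, 0 < eps -> exists N : nat, forall m n : nat,
        (N <= m)%N -> (N <= n)%N -> hnorm (u m - u n) < eps) ->
    exists l : V, forall eps : R, 0 < eps -> exists N : nat, forall n : nat,
        (N <= n)%N -> hnorm (u n - l) < eps }.

Definition span (S : set V) : set V :=
  [set y | exists (s : seq V) (a : seq R[i]),
      (forall k, (k < size s)%N -> S (nth 0 s k)) /\
      y = \sum_(k < size s) a`_k *: s`_k].

Definition cspan (S : set V) : set V :=
  [set x | forall eps : R, 0 < eps -> exists y, span S y /\ hnorm (x - y) < eps].

Definition ominus (M L : set V) : set V :=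
  [set x | M x /\ forall y, L y -> ip x y = 0].

(* c[M,N] (sup of the empty set is 0) *)
Definition cangle (M N : set V) : R :=
  sup [set r | exists x y, ominus M (M `&` N) x /\ ominus N (M `&` N) y /\
                 hnorm x = 1 /\ hnorm y = 1 /\ r = cabs (ip x y)].

Definition bounded_op (T : V -> V) : Prop :=
  (forall (a : R[i]) (x y : V), T (a *: x + y) = a *: T x + T y) /\
  exists M : R, forall x, hnorm (T x) <= M * hnorm x.

Definition nullspace (T : V -> V) : set V := [set x | T x = 0].

Definition orthonormal_basis (e : nat -> V) : Prop :=
  (forall m n, ip (e m) (e n) = if m == n then 1 else 0) /\
  cspan (range e) = setT.

Definition diag_proj (e : nat -> V) (Q : V -> V) : Prop :=
  bounded_op Q /\ (forall n, exists d : R[i], Q (e n) = d *: e n) /\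
  (forall x, Q (Q x) = Q x) /\ (forall x y, ip (Q x) y = ip x (Q y)).

Definition compatible (e : nat -> V) (S : set V) : Prop :=
  sup [set c | exists Q, diag_proj e Q /\ c = cangle S (range Q)] < 1.

Definition frame_sum (xi : nat -> V) (J : set nat) (x : V) : \bar R :=
  (\sum_(n <oo | n \in J) (abs2 (ip x (xi n)))%:E)%E.

Definition frame_of (K : set V) (xi : nat -> V) (J : set nat) (A B : R) : Prop :=
  0 < A /\ 0 < B /\ forall x, K x ->
    ((A * hnorm x ^+ 2)%:E <= frame_sum xi J x)%E /\
    (frame_sum xi J x <= (B * hnorm x ^+ 2)%:E)%E.

Definition riesz_frame (xi : nat -> V) : Prop :=
  (exists A B, frame_of setT xi setT A B) /\
  exists C : R, 0 < C /\ forall J : set nat, exists A B,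
    C <= A /\ frame_of (cspan (xi @` J)) xi J A B.

End Hilbert.

(* Main.v *)
Require Import Defs.
From mathcomp Require Import all_boot all_order all_algebra.
From mathcomp Require Import complex ring lra.
From mathcomp Require Import all_classical all_reals.
From mathcomp Require Import ereal topology normedtype sequences.
Set Implicit Arguments. Unset Strict Implicit. Unset Printing Implicit Defensive.
Import Order.TTheory GRing.Theory Num.Theory.
Local Open Scope ring_scope.
Local Open Scope classical_set_scope.

(** For a set of indices J let H_J be the closed span of the e_n, n in J; the
    ranges of the diagonal projections are exactly the H_J. The frame sum of x
    over J is the squared norm of the projection of T^* x onto H_J, so the lower
    frame inequality with constant d^2 on the closure of T(H_J) is equivalent to
    |T y| >= d |y| for all y in H_J orthogonal to N(T) /\ H_J. If y has norm one
    and x is a unit vector of N(T), then |T y| = |T (y - <y, x> x)| is at most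
    |T| sqrt(1 - |<x, y>|^2), which turns a uniform d into a uniform bound on the
    angles c[N(T), H_J]. Conversely, surjectivity makes T bounded below by some
    g > 0 on the orthogonal complement of N(T), and an angle at most c gives
    |T y| >= g sqrt(1 - c^2) |y|. *)

(** * Real estimates for limits and suprema *)

Lemma le0_small (R : realType) (a b : R) :
  0 <= b -> (forall eps, 0 < eps -> a <= eps * b) -> a <= 0.
Proof.
move=> b0 h; rewrite leNgt; apply/negP => a0.
have e0 : 0 < a / (b + 1) by rewrite divr_gt0//; lra.
have := h _ e0; rewrite mulrAC ler_pdivlMr; last lra.
by rewrite mulrDr mulr1; lra.
Qed.

Lemma invSn_small (R : realType) (eps : R) : 0 < eps ->
  exists n0 : nat, forall n, (n0 <= n)%N -> n.+1%:R^-1 < eps.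
Proof.
move=> e0; exists (Num.trunc eps^-1) => n hn.
rewrite invf_plt ?posrE//; apply: (lt_le_trans (Num.Theory.truncnS_gt _)).
by rewrite ler_nat.
Qed.

Lemma geo_small (R : realType) (q : R) n : 3 * q = 1 -> q ^+ n <= n.+1%:R^-1.
Proof.
move=> q3; rewrite -[leRHS]mul1r ler_pdivlMr//.
elim: n => [|n IH]; first by rewrite expr0 mul1r.
have a0 : 0 <= q ^+ n by apply: exprn_ge0; lra.
have k1 : 1 <= n.+1%:R :> R by rewrite ler1n.
have h := ler_wpM2l a0 k1; rewrite mulr1 in h.
rewrite exprS -[n.+2%:R]natr1.
have -> : q * q ^+ n * (n.+1%:R + 1) = 3^-1 * (q ^+ n * n.+1%:R + q ^+ n).
  have -> : q = 3^-1 by lra.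
  ring.
by move: IH h; move: (q ^+ n) (q ^+ n * _) => a b; lra.
Qed.

(** The sign of k covers the empty set, whose [sup] is 0. *)
Lemma sup_le_nneg (R : realType) (E : set R) k :
  0 <= k -> (forall r, E r -> r <= k) -> sup E <= k.
Proof.
move=> k0 h; have [->|/set0P E0] := eqVneq E set0; first by rewrite sup0.
exact: ge_sup.
Qed.

(** * The real inner product Re <x, y> and its norm *)

Section InnerProduct.
Variables (R : realType) (V : lmodType R[i]) (ip : V -> V -> R[i]).
Hypothesis hH : hilbert_space ip.

(** The real part makes V a real Hilbert space with the same norm, so projections and representing
    vectors can be found over the reals; [csubspace_rdot0] returns to complex orthogonality. *)
Definition re_ip (x y : V) : R := complex.Re (ip x y).
Local Notation rdot := re_ip.
Local Notation N := (hnorm ip).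
Local Notation "r %:c" := (real_complex R r) (at level 2, format "r %:c").

Lemma rdotC x y : rdot x y = rdot y x.
Proof. by rewrite /re_ip (ip_conj hH y x); case: (ip y x). Qed.

Lemma rdotDl x y z : rdot (x + y) z = rdot x z + rdot y z.
Proof.
rewrite /re_ip -[x in LHS]scale1r (ip_linear hH) mul1r.
by case: (ip x z) => ??; case: (ip y z).
Qed.

Lemma rdot0l z : rdot 0 z = 0.
Proof. by have := rdotDl 0 0 z; rewrite addr0; lra. Qed.

Lemma ip0l z : ip 0 z = 0.
Proof.
have := ip_linear hH 1 0 0 z; rewrite scale1r mul1r addr0 => h.
by apply: (@addrI _ (ip 0 z)); rewrite addr0 -h.
Qed.

Lemma ipZl (a : R[i]) x z : ip (a *: x) z = a * ip x z.
Proof. by rewrite -[a *: x]addr0 (ip_linear hH) ip0l addr0. Qed.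

Lemma ipDl x y z : ip (x + y) z = ip x z + ip y z.
Proof. by rewrite -[x in LHS]scale1r (ip_linear hH) mul1r. Qed.

Lemma ip_suml (I : Type) (r : seq I) (P : pred I) (F : I -> V) z :
  ip (\sum_(i <- r | P i) F i) z = \sum_(i <- r | P i) ip (F i) z.
Proof. by apply: (big_morph (fun x => ip x z)) => [x y|]; rewrite ?ipDl ?ip0l. Qed.

Lemma rdotZl (r : R) x z : rdot (r%:c *: x) z = r * rdot x z.
Proof. by rewrite /re_ip ipZl; case: (ip x z) => a b /=; ring. Qed.

Lemma rdotJl (a : R[i]) x z : rdot (a *: x) z = rdot x (conjc a *: z).
Proof.
rewrite /re_ip ipZl (ip_conj hH (_ *: z)) ipZl (ip_conj hH x z).
by case: (ip x z) a => ?? [??] /=; ring.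
Qed.

Lemma rdotNl x z : rdot (- x) z = - rdot x z.
Proof. by have := rdotDl x (- x) z; rewrite subrr rdot0l; lra. Qed.

Lemma rdotBl x y z : rdot (x - y) z = rdot x z - rdot y z.
Proof. by rewrite rdotDl rdotNl. Qed.

Lemma rdotDr x y z : rdot z (x + y) = rdot z x + rdot z y.
Proof. by rewrite !(rdotC z) rdotDl. Qed.

Lemma rdotNr x z : rdot z (- x) = - rdot z x.
Proof. by rewrite !(rdotC z) rdotNl. Qed.

Lemma rdotBr x y z : rdot z (x - y) = rdot z x - rdot z y.
Proof. by rewrite !(rdotC z) rdotBl. Qed.

Lemma rdot0r z : rdot z 0 = 0.
Proof. by rewrite rdotC rdot0l. Qed.

Lemma rdotZr (r : R) x z : rdot z (r%:c *: x) = r * rdot z x.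
Proof. by rewrite !(rdotC z) rdotZl. Qed.

Lemma rdot_ge0 x : 0 <= rdot x x.
Proof. exact: ip_pos. Qed.

Lemma ip_self x : ip x x = (rdot x x)%:c.
Proof.
have := ip_conj hH x x; rewrite /re_ip; case: (ip x x) => a b /= [hb].
by apply/eqP; rewrite eq_complex /= eqxx /=; apply/eqP; lra.
Qed.

Lemma rdot_eq0 x : rdot x x = 0 -> x = 0.
Proof. by move=> h; apply: (ip_def hH); rewrite ip_self h. Qed.

Lemma normE x : N x ^+ 2 = rdot x x.
Proof. exact/sqr_sqrtr/rdot_ge0. Qed.

Lemma norm_ge0 x : 0 <= N x.
Proof. exact: sqrtr_ge0. Qed.

Lemma norm_eq0 x : N x = 0 -> x = 0.
Proof. by move=> h; apply: rdot_eq0; rewrite -normE h expr0n. Qed.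

Lemma norm0 : N 0 = 0.
Proof. by apply/eqP; rewrite -sqrf_eq0 normE rdot0l. Qed.

Lemma norm_gt0 x : x <> 0 -> 0 < N x.
Proof.
move=> x0; rewrite lt_neqAle norm_ge0 andbT eq_sym.
by apply/eqP => /norm_eq0.
Qed.

Lemma rdot_norm_le x y : `|rdot x y| <= N x * N y.
Proof.
rewrite -ler_sqr ?nnegrE ?mulr_ge0 ?norm_ge0//.
rewrite real_normK ?num_real// exprMn !normE.
have [/rdot_eq0->|/eqP y0] := eqVneq (rdot y y) 0.
  by rewrite !rdot0r expr0n mulr0.
have yy : 0 < rdot y y by rewrite lt_neqAle rdot_ge0 andbT eq_sym; apply/eqP.
have := rdot_ge0 ((rdot y y)%:c *: x - (rdot x y)%:c *: y).
rewrite !rdotBl !rdotBr !rdotZl !rdotZr (rdotC y x) => h.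
rewrite -subr_ge0 -(pmulr_rge0 _ yy); lra.
Qed.

Lemma rdot_le x y : rdot x y <= N x * N y.
Proof. exact: le_trans (ler_norm _) (rdot_norm_le x y). Qed.

Lemma normZ (r : R) x : N (r%:c *: x) = `|r| * N x.
Proof.
apply/eqP; rewrite -(@eqrXn2 _ 2) ?mulr_ge0 ?norm_ge0//.
by rewrite exprMn !normE rdotZl rdotZr real_normK ?num_real// mulrA expr2.
Qed.

Lemma normN x : N (- x) = N x.
Proof. by rewrite /hnorm -/(rdot _ _) -/(rdot x x) rdotNl rdotNr opprK. Qed.

Lemma normBC x y : N (x - y) = N (y - x).
Proof. by rewrite -normN opprB. Qed.

Lemma normD x y : N (x + y) <= N x + N y.
Proof.
rewrite -ler_sqr ?nnegrE ?addr_ge0 ?norm_ge0//.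
rewrite sqrrD !normE rdotDl !rdotDr (rdotC y x).
by have := rdot_le x y; lra.
Qed.

Lemma normB_le x y z : N (x - z) <= N (x - y) + N (y - z).
Proof. by apply: le_trans (normD _ _); rewrite addrA subrK. Qed.

Lemma normB2 x y : N (x - y) ^+ 2 = N x ^+ 2 - 2 * rdot x y + N y ^+ 2.
Proof. by rewrite !normE rdotBl !rdotBr (rdotC y x); ring. Qed.

End InnerProduct.

(** * Orthogonal projection and Riesz representation *)

Section Projection.
Variables (R : realType) (V : lmodType R[i]) (ip : V -> V -> R[i]).
Hypothesis hH : hilbert_space ip.

Local Notation rdot := (re_ip ip).
Local Notation N := (hnorm ip).
Local Notation "r %:c" := (real_complex R r) (at level 2, format "r %:c").

Definition rsubspace (P : set V) : Prop :=
  P 0 /\ forall (r : R) x y, P x -> P y -> P (r%:c *: x + y).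

Definition csubspace (P : set V) : Prop :=
  P 0 /\ forall (a : R[i]) x y, P x -> P y -> P (a *: x + y).

Definition hclosed (P : set V) : Prop :=
  forall x, (forall eps : R, 0 < eps -> exists y, P y /\ N (x - y) < eps) -> P x.

Lemma csubspaceW P : csubspace P -> rsubspace P.
Proof. by case=> h0 h; split=> // r; apply: h. Qed.

Lemma rsubspaceI P Q : rsubspace P -> rsubspace Q -> rsubspace (P `&` Q).
Proof. by move=> [p0 hp] [q0 hq]; split=> // r x y [??] [??]; split; auto. Qed.

Lemma csubspaceI P Q : csubspace P -> csubspace Q -> csubspace (P `&` Q).
Proof. by move=> [p0 hp] [q0 hq]; split=> // r x y [??] [??]; split; auto. Qed.

Lemma hclosedI P Q : hclosed P -> hclosed Q -> hclosed (P `&` Q).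
Proof.
by move=> hp hq x h; split; [apply: hp|apply: hq] => eps /h [y [[??]?]]; exists y.
Qed.

Lemma rsubD P x y : rsubspace P -> P x -> P y -> P (x + y).
Proof. by case=> _ h px py; rewrite -[x]scale1r; exact: (h 1). Qed.

Lemma rsubZ P (r : R) x : rsubspace P -> P x -> P (r%:c *: x).
Proof. by case=> h0 h px; rewrite -[_ *: x]addr0; exact: h. Qed.

Lemma rsubN P x : rsubspace P -> P x -> P (- x).
Proof. by move=> h px; have := rsubZ (-1) h px; rewrite rmorphN1 scaleN1r. Qed.

Lemma rsubB P x y : rsubspace P -> P x -> P y -> P (x - y).
Proof. by move=> h px py; apply: rsubD => //; apply: rsubN. Qed.

(** A sequence u_n in P minimising |x - u_n|^2 up to 1/(n+1)^2 has x - u_n orthogonal to P up to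
    1/(n+1). This near-orthogonality makes u_n Cauchy and passes to the limit p. *)
Lemma ortho_proj P x : rsubspace P -> hclosed P ->
  exists p, P p /\ forall y, P y -> rdot (x - p) y = 0.
Proof.
move=> sP cP; have [P0 _] := sP.
pose D := [set N (x - y) ^+ 2 | y in P].
have iD : has_inf D.
  split; first by exists (N (x - 0) ^+ 2), 0.
  by exists 0 => _ [y _ <-]; exact: sqr_ge0.
have approx (n : nat) : exists y, P y /\
    N (x - y) ^+ 2 < inf D + (n.+1%:R^-1) ^+ 2.
  have [] := inf_adherent (exprn_gt0 2 (_ : 0 < n.+1%:R^-1 :> R)) iD.
    by rewrite invr_gt0.
  by move=> _ [y Py <-] hy; exists y.
have [u hu] := choice approx.
have Pu n : P (u n) by have [] := hu n.
have orth n y : P y -> `|rdot (x - u n) y| <= n.+1%:R^-1 * N y.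
  move=> Py; have [->|/eqP y0] := eqVneq y 0.
    by rewrite rdot0r// normr0 norm0// mulr0.
  have := norm_gt0 hH y0 => Ny.
  rewrite -ler_sqr ?nnegrE ?mulr_ge0 ?invr_ge0 ?(norm_ge0 ip)//.
  rewrite real_normK ?num_real// exprMn.
  (* This t minimises |x - u_n - t y|^2; comparison with inf D bounds r^2 / |y|^2 by 1/(n+1)^2. *)
  set r := rdot _ _; pose t := r / N y ^+ 2.
  have : inf D <= N (x - u n - t%:c *: y) ^+ 2.
    apply: ge_inf; first by case: iD.
    exists (u n + t%:c *: y); last by rewrite opprD addrA.
    by apply: rsubD => //; exact: rsubZ.
  have [_ hn] := hu n.
  rewrite normB2// rdotZr// normZ// exprMn real_normK ?num_real// -/r => h.
  rewrite -ler_pdivrMr ?exprn_gt0//.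
  have e1 : t * r = r ^+ 2 / N y ^+ 2 by rewrite /t; ring.
  have e2 : t ^+ 2 * N y ^+ 2 = r ^+ 2 / N y ^+ 2.
    by rewrite /t; field; rewrite lt0r_neq0.
  rewrite {}e1 {}e2 in h; move: h hn.
  by move: (r ^+ 2 / _) (_ ^-1 ^+ 2) => q eta; lra.
have cauchy m n : N (u m - u n) <= m.+1%:R^-1 + n.+1%:R^-1.
  have [->|/eqP y0] := eqVneq (u m - u n) 0.
    by rewrite norm0// addr_ge0 ?invr_ge0.
  have Ny := norm_gt0 hH y0.
  have Py : P (u m - u n) by exact: rsubB.
  rewrite -(ler_pM2r Ny) -expr2 normE// mulrDl.
  have h1 := le_trans (ler_norm _) (orth n _ Py).
  have := orth m _ Py; rewrite ler_norml => /andP[h3 _].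
  (* Both x - u_n and x - u_m are nearly orthogonal to u_m - u_n, which is their difference. *)
  suff -> : rdot (u m - u n) (u m - u n) =
     rdot (x - u n) (u m - u n) - rdot (x - u m) (u m - u n).
    by rewrite [leRHS]addrC; apply: lerD => //; rewrite lerNl.
  by rewrite -rdotBl//; congr rdot; rewrite opprB [RHS]addrC addrA subrK.
have [] := ip_complete hH (u := u).
  move=> eps e0; have [n0 h0] := invSn_small (divr_gt0 e0 (ltr0n R 2)).
  exists n0 => m n /h0 hm /h0 hn; apply: le_lt_trans (cauchy m n) _.
  by rewrite [eps]splitr ltrD.
move=> p hp; exists p; split.
  apply: cP => eps /hp [n0 h0]; exists (u n0); split => //.
  by rewrite normBC//; exact: h0.
move=> y Py; apply/eqP; rewrite -normr_le0.
apply: (le0_small (norm_ge0 ip y)) => eps e0.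
have e2 := divr_gt0 e0 (ltr0n R 2).
have [n0 h0] := invSn_small e2; have [n1 h1] := hp _ e2.
pose n := maxn n0 n1.
have {}h0 := h0 n (leq_maxl _ _); have {}h1 := h1 n (leq_maxr _ _).
have -> : x - p = (x - u n) + (u n - p) by rewrite addrA subrK.
rewrite rdotDl//; apply: le_trans (ler_normD _ _) _.
apply: le_trans (lerD (orth n _ Py) (rdot_norm_le hH _ _)) _.
by rewrite -mulrDl ler_wpM2r ?(norm_ge0 ip)// [leRHS]splitr lerD// ltW.
Qed.

(* The representing vector spans the orthogonal complement of the kernel of f in P. *)
Lemma riesz_rep P (f : V -> R) (M : R) : rsubspace P -> hclosed P ->
    (forall (r : R) x y, f (r%:c *: x + y) = r * f x + f y) ->
    (forall x, `|f x| <= M * N x) ->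
  exists z, P z /\ forall w, P w -> f w = rdot z w.
Proof.
move=> sP cP lf bf.
have [[w0 [Pw0 fw0]]|h] := pselect (exists w, P w /\ f w <> 0); last first.
  exists 0; split; first by case: sP.
  by move=> w Pw; rewrite rdot0l//; apply: contrapT => fw; apply: h; exists w.
have f0 : f 0 = 0 by have := lf 1 0 0; rewrite scaler0 addr0; lra.
have fB x y : f (x - y) = f x - f y.
  by rewrite addrC -scaleN1r -(rmorphN1 (real_complex R)) lf; ring.
have sK : rsubspace (P `&` [set w | f w = 0]).
  apply: rsubspaceI => //; split => //= r x y hx hy.
  by rewrite lf hx hy mulr0 addr0.
have cK : hclosed (P `&` [set w | f w = 0]).
  apply: hclosedI => // x hx /=; apply/eqP; rewrite -normr_le0.
  have M0 : 0 <= `|M| by [].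
  apply: (le0_small M0) => eps /hx [y [/= fy xy]].
  have -> : f x = f (x - y) by rewrite fB fy subr0.
  apply: le_trans (bf _) _; rewrite mulrC.
  apply: le_trans (ler_wpM2l (norm_ge0 ip _) (ler_norm M)) _.
  by rewrite ler_wpM2r// ltW.
have [p [[Pp fp] op]] := ortho_proj w0 sK cK.
pose u := w0 - p.
have fu : f u = f w0 by rewrite fB fp subr0.
have Pu : P u by exact: rsubB.
have u0 : rdot u u != 0.
  by apply/eqP => /(rdot_eq0 hH) uu; apply: fw0; rewrite -fu uu.
exists ((f u / rdot u u)%:c *: u); split; first exact: rsubZ.
move=> w Pw.
(* This vector lies in the kernel of f, so it is orthogonal to u; solving for f w gives the
   formula. *)
have /op : (P `&` [set w | f w = 0]) ((f u)%:c *: w - (f w)%:c *: u).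
  split; first by apply: rsubB => //; exact: rsubZ.
  rewrite /= fB -[_ *: w]addr0 -[_ *: u]addr0 !lf f0; ring.
rewrite -/u rdotBr// !rdotZr// rdotZl// => h.
apply: (mulIf u0); rewrite mulrAC divfK//.
by apply/eqP; rewrite eq_sym -subr_eq0 h.
Qed.

End Projection.

(** * Lower bounds for a bounded operator and its adjoint *)

Section BoundedOperators.
Variables (R : realType) (V : lmodType R[i]) (ip : V -> V -> R[i]).
Hypothesis hH : hilbert_space ip.
Variable T : V -> V.
Hypothesis hT : bounded_op ip T.

Local Notation rdot := (re_ip ip).
Local Notation N := (hnorm ip).
Local Notation hclosed := (hclosed ip).
Local Notation "r %:c" := (real_complex R r) (at level 2, format "r %:c").

Lemma op_linear a x y : T (a *: x + y) = a *: T x + T y.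
Proof. by case: hT. Qed.

Lemma opD x y : T (x + y) = T x + T y.
Proof. by rewrite -[x in LHS]scale1r op_linear scale1r. Qed.

Lemma op0 : T 0 = 0.
Proof. by apply: (@addrI _ (T 0)); rewrite -opD !addr0. Qed.

Lemma opZ a x : T (a *: x) = a *: T x.
Proof. by rewrite -[a *: x]addr0 op_linear op0 addr0. Qed.

Lemma opN x : T (- x) = - T x.
Proof. by rewrite -scaleN1r opZ scaleN1r. Qed.

Lemma opB x y : T (x - y) = T x - T y.
Proof. by rewrite opD opN. Qed.

Lemma op_sum (I : Type) (r : seq I) (P : pred I) (F : I -> V) :
  T (\sum_(i <- r | P i) F i) = \sum_(i <- r | P i) T (F i).
Proof. exact: (big_morph T opD op0). Qed.

Lemma op_bound : exists M, 0 < M /\ forall x, N (T x) <= M * N x.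
Proof.
case: hT => _ [M hM]; exists (`|M| + 1); split => [|x].
  by rewrite ltr_wpDl.
apply: le_trans (hM x) _; apply: ler_wpM2r; first exact: (norm_ge0 ip).
by have := ler_norm M; lra.
Qed.

(** With P_H the projection onto H, [below] says that P_H T^* is bounded below on K. Its range on K
    is then closed and contains every y in H orthogonal to the kernel of T in H; writing y = P_H T^*
    x gives |y|^2 = <x, T y> <= |x| |T y| <= |y| |T y| / g. *)
Lemma op_bounded_below (H K : set V) (g : R) :
    rsubspace H -> hclosed H -> rsubspace K -> hclosed K ->
    (forall w, H w -> K (T w)) -> 0 < g ->
    (forall x s, K x -> 0 <= s -> (forall w, H w -> rdot x (T w) <= s * N w) ->
       g * N x <= s) ->
  forall y, H y -> (forall w, H w -> T w = 0 -> rdot y w = 0) ->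
    g * N y <= N (T y).
Proof.
move=> sH cH sK cK HK g0 below y Hy oy.
have [M [M0 hM]] := op_bound.
(* For z in H this says z = P_H T^* x, as a relation, so that no adjoint has to be constructed; [L]
   below is the range. *)
pose pair x z := K x /\ forall w, H w -> rdot x (T w) = rdot z w.
have pairB x z x' z' : pair x z -> pair x' z' -> pair (x - x') (z - z').
  move=> [Kx hx] [Kx' hx']; split; first exact: rsubB.
  by move=> w Hw; rewrite !rdotBl// hx// hx'.
have pair_le x z : pair x z -> g * N x <= N z.
  move=> [Kx hx]; apply: below => // [|w Hw]; first exact: norm_ge0.
  by rewrite hx//; exact: rdot_le.
pose L z := H z /\ exists x, pair x z.
have sL : rsubspace L.
  split.
    split; first by case: sH.
    exists 0; split; first by case: sK.
    by move=> w _; rewrite !rdot0l.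
  move=> r z z' [Hz [x [Kx hx]]] [Hz' [x' [Kx' hx']]]; split.
    by case: sH => _; apply.
  exists (r%:c *: x + x'); split; first by case: sK => _; apply.
  by move=> w Hw; rewrite !rdotDl// !rdotZl// hx// hx'.
(* Since [below] controls x by z, a Cauchy sequence of z's in L drags along a
   Cauchy sequence of x's. *)
have cL : hclosed L.
  move=> z hz; split; first by apply: cH => eps /hz [z' [[? _] ?]]; exists z'.
  have approx (n : nat) : exists xz : V * V, pair xz.1 xz.2 /\
      N (z - xz.2) < n.+1%:R^-1.
    have [|z' [[_ [x hx]] hz']] := hz n.+1%:R^-1; first by rewrite invr_gt0.
    by exists (x, z').
  have [u hu] := choice approx.
  have [] := ip_complete hH (u := fun n => (u n).1).
    move=> eps e0.
    have [n0 h0] := invSn_small (divr_gt0 (mulr_gt0 g0 e0) (ltr0n R 2)).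
    exists n0 => m n hm hn.
    have [pm zm] := hu m; have [pn zn] := hu n.
    have := pair_le _ _ (pairB _ _ _ _ pm pn) => h.
    rewrite -(ltr_pM2l g0); apply: le_lt_trans h _.
    apply: le_lt_trans (normB_le hH _ z _) _.
    rewrite [ltRHS]splitr ltrD//; last exact: lt_trans zn (h0 _ hn).
    by rewrite normBC//; exact: lt_trans zm (h0 _ hm).
  move=> x hx; exists x; split.
    apply: cK => eps /hx [n0 h0]; exists (u n0).1; split.
      by have [[]] := hu n0.
    by rewrite normBC//; exact: h0.
  move=> w Hw; apply/eqP; rewrite -subr_eq0 -normr_le0.
  apply: (le0_small (b := N (T w) + N w)).
    by rewrite addr_ge0 ?(norm_ge0 ip).
  move=> eps e0; have [n0 h0] := invSn_small e0; have [n1 h1] := hx _ e0.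
  pose n := maxn n0 n1; have [[_ pn] zn] := hu n.
  have -> : rdot x (T w) - rdot z w =
      rdot (x - (u n).1) (T w) - rdot (z - (u n).2) w.
    by rewrite !rdotBl// pn//; ring.
  apply: le_trans (ler_normB _ _) _; rewrite mulrDr; apply: lerD.
    apply: le_trans (rdot_norm_le hH _ _) _.
    rewrite ler_wpM2r ?(norm_ge0 ip)// normBC// ltW//.
    by apply: h1; exact: leq_maxr.
  apply: le_trans (rdot_norm_le hH _ _) _.
  rewrite ler_wpM2r ?(norm_ge0 ip)// ltW//; apply: lt_trans zn _.
  by apply: h0; exact: leq_maxl.
have [p [Lp op]] := ortho_proj hH y sL cL.
pose d := y - p.
have Hp : H p by case: Lp.
have Hd : H d by exact: rsubB.
(* z = P_H T^* T d lies in [L], while d is orthogonal to [L]; hence |T d|^2 = <z, d> = 0. *)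
have [z [Hz hz]] : exists z, H z /\ forall w, H w -> rdot (T d) (T w) = rdot z w.
  apply: (riesz_rep (M := N (T d) * M) hH) => //.
    by move=> r a b; rewrite op_linear rdotDr// rdotZr.
  move=> w; apply: le_trans (rdot_norm_le hH _ _) _.
  by rewrite -mulrA ler_wpM2l ?(norm_ge0 ip).
have Td : T d = 0.
  apply: (rdot_eq0 hH); rewrite hz// rdotC//; apply: op; split=> //.
  by exists (T d); split => //; exact: HK.
(* d is now in the kernel of T in H, to which both y and p are orthogonal. *)
have d0 : d = 0.
  apply: (rdot_eq0 hH); rewrite {1}/d rdotBl// oy// sub0r.
  by case: Lp => _ [x [_ hx]]; rewrite -hx// Td rdot0r// oppr0.
have [_ [x px]] : L y by rewrite -[y](subrK p) -/d d0 add0r.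
have hx := pair_le _ _ px.
have [->|/eqP/(norm_gt0 hH) y0] := eqVneq y 0.
  by rewrite norm0// op0 norm0// mulr0.
rewrite -(ler_pM2r y0) -mulrA -expr2 normE//; case: px => _ <- //.
apply: le_trans (ler_wpM2l (ltW g0) (rdot_le hH _ _)) _.
by rewrite mulrA [leRHS]mulrC ler_wpM2r ?(norm_ge0 ip).
Qed.

(* Gliding hump: if T^* were not bounded below, unit vectors v_n with
   |T^* v_n| < 3^-n / (n+1) would yield a vector x = sum_n +-3^-n v_n with
   |<x, v_n>| >= 3^-n / 2, which is then not in the range of T. *)
Lemma surj_adjoint_below : (forall y, exists x, T x = y) ->
  exists g, 0 < g /\ forall x s, 0 <= s ->
    (forall w, rdot x (T w) <= s * N w) -> g * N x <= s.
Proof.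
move=> surj; apply: contrapT => hn.
(* With ratio 1/3 the terms after the n-th sum to at most (3/2) q^(n+1) = q^n / 2, so half of the
   hump q^n along v_n survives. *)
pose q : R := 3^-1; have q3 : 3 * q = 1 by rewrite /q; lra.
have q0 : 0 < q by lra.
have qn n : 0 < q ^+ n by exact: exprn_gt0.
clearbody q.
have hump (n : nat) : exists v, N v = 1 /\
    forall w, rdot v (T w) <= q ^+ n * n.+1%:R^-1 * N w.
  have g0 : 0 < q ^+ n * n.+1%:R^-1 by rewrite mulr_gt0// invr_gt0.
  (* Otherwise this constant would serve as g: an x violating the bound yields v by
     normalisation. *)
  apply: contrapT => hv; apply: hn; exists (q ^+ n * n.+1%:R^-1); split=> //.
  move=> x s s0 hx; rewrite leNgt; apply/negP => hs; apply: hv.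
  have x0 : 0 < N x.
    by rewrite -(pmulr_rgt0 _ g0); exact: le_lt_trans s0 hs.
  exists ((N x)^-1%:c *: x); split.
    by rewrite normZ// gtr0_norm ?invr_gt0// mulVf// lt0r_neq0.
  move=> w; rewrite rdotZl// mulrC ler_pdivrMr//; apply: le_trans (hx w) _.
  by rewrite mulrAC ler_wpM2r ?(norm_ge0 ip)// ltW.
have [v hv] := choice hump.
(* The sign follows that of <x, v_n>, so the new term never cancels the component already there. *)
pose step n x := x + (if 0 <= rdot x (v n) then q ^+ n else - q ^+ n)%:c *: v n.
pose u := fix u n := if n is m.+1 then step m (u m) else 0.
have vv n : rdot (v n) (v n) = 1 by rewrite -normE// (hv n).1 expr1n.
have u_big n : q ^+ n <= `|rdot (u n.+1) (v n)|.
  rewrite /= /step rdotDl// rdotZl// vv mulr1; have qn0 := qn n.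
  case: ifPn => [h0|]; first by rewrite ger0_norm; lra.
  by rewrite -ltNge => h0; rewrite ltr0_norm; lra.
have u_step n : N (u n.+1 - u n) = q ^+ n.
  rewrite /= /step addrC addKr normZ// (hv n).1 mulr1.
  by case: ifP => _; rewrite ?normrN gtr0_norm.
have u_tail n k : N (u (n + k)%N - u n) <= (3 / 2) * (q ^+ n - q ^+ (n + k)).
  elim: k => [|k IH]; first by rewrite addn0 !subrr norm0// mulr0.
  apply: le_trans (normB_le hH _ (u (n + k)%N) _) _.
  rewrite addnS u_step exprS.
  have : q * q ^+ (n + k) = 3^-1 * q ^+ (n + k) by congr (_ * _); lra.
  by move: IH; move: (q ^+ n) (q ^+ (n + k)) (q * _) => *; lra.
have u_tail' n m : (n <= m)%N -> N (u m - u n) <= (3 / 2) * q ^+ n.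
  move=> nm; rewrite -(subnKC nm); apply: le_trans (u_tail _ _) _.
  by have := qn (n + (m - n))%N; lra.
have [] := ip_complete hH (u := u).
  move=> eps e0; have e4 : 0 < eps / 4 by lra.
  have [n0 h0] := invSn_small e4.
  exists n0 => m n hm hn'; apply: le_lt_trans (normB_le hH _ (u n0) _) _.
  have := u_tail' _ _ hm; have := u_tail' _ _ hn'; rewrite (normBC hH (u n)).
  have := le_lt_trans (geo_small n0 q3) (h0 n0 (leqnn _)); lra.
move=> x hx.
have x_tail n : N (x - u n) <= (3 / 2) * q ^+ n.
  apply/ler_addgt0Pr => eps /hx [n0 h0].
  have := h0 (maxn n0 n) (leq_maxl _ _).
  have := u_tail' _ _ (leq_maxr n0 n); have := normB_le hH x (u (maxn n0 n)) (u n).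
  by rewrite (normBC hH x (u (maxn n0 n))); lra.
have x_big n : q ^+ n / 2 <= `|rdot x (v n)|.
  have := u_big n; have := rdot_norm_le hH (x - u n.+1) (v n).
  rewrite (hv n).1 mulr1 => h1 h2; have := x_tail n.+1; rewrite exprS mulrA.
  have -> : 3 / 2 * q = 2^-1 by lra.
  rewrite rdotBl// in h1 => h3.
  have := ler_normD (rdot x (v n)) (rdot (u n.+1) (v n) - rdot x (v n)).
  by rewrite addrC subrK distrC; lra.
have [w Tw] := surj x.
(* For x = T w the choice of v_n bounds |<v_n, T w>| by q^n |w| / (n+1), against q^n / 2 from
   below. *)
have w_big n : 2^-1 <= n.+1%:R^-1 * N w.
  rewrite -(ler_pM2l (qn n)) mulrA; apply: le_trans (x_big n) _.
  rewrite -Tw rdotC// ler_norml (hv n).2 andbT lerNl -rdotNr// -opN.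
  by rewrite -(normN hH w); exact: (hv n).2.
suff : (2^-1 : R) <= 0 by lra.
apply: (le0_small (norm_ge0 ip w)) => eps /invSn_small [n h].
by apply: le_trans (w_big n) _; rewrite ler_wpM2r ?(norm_ge0 ip)// ltW// h.
Qed.

End BoundedOperators.

(** * Spans, closed spans and complex projections *)

Section Spans.
Variables (R : realType) (V : lmodType R[i]) (ip : V -> V -> R[i]).
Hypothesis hH : hilbert_space ip.

Local Notation rdot := (re_ip ip).
Local Notation N := (hnorm ip).
Local Notation hclosed := (hclosed ip).
Local Notation span := (@Defs.span R V).
Local Notation cspan := (cspan ip).
Local Notation "r %:c" := (real_complex R r) (at level 2, format "r %:c").

Lemma ip_linear_r a x y z : ip z (a *: x + y) = conjc a * ip z x + ip z y.
Proof.
rewrite (ip_conj hH (_ + _) z) (ip_conj hH x z) (ip_conj hH y z).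
by rewrite (ip_linear hH) rmorphD rmorphM.
Qed.

Lemma abs2E a : (abs2 a)%:c = a * conjc a :> R[i].
Proof.
case: a => a b; apply/eqP; rewrite eq_complex /= /abs2 /=.
by apply/andP; split; apply/eqP; ring.
Qed.

Lemma cabs_ge0 a : 0 <= cabs a :> R.
Proof. exact: sqrtr_ge0. Qed.

Lemma cabsE a : cabs a ^+ 2 = abs2 a :> R.
Proof. by rewrite sqr_sqrtr// /abs2 addr_ge0 ?sqr_ge0. Qed.

Lemma normCZ (a : R[i]) x : N (a *: x) = cabs a * N x.
Proof.
apply/eqP; rewrite -(@eqrXn2 _ 2) ?mulr_ge0 ?norm_ge0 ?cabs_ge0//.
rewrite exprMn cabsE !normE// rdotJl// scalerA mulrC -abs2E rdotZr//.
Qed.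

(** The imaginary part of <x, y> is the real part of <x, i y>, and i y stays in a complex
    subspace. *)
Lemma csubspace_rdot0 P x : csubspace P -> (forall y, P y -> rdot x y = 0) ->
  forall y, P y -> ip x y = 0.
Proof.
move=> [P0 hP] h y Py; have hr := h _ Py.
have := h ('i%C *: y + 0) (hP _ _ _ Py P0).
move: hr; rewrite /re_ip ip_linear_r.
rewrite (ip_conj hH 0 x) ip0l// raddf0 addr0.
case: (ip x y) => a b /= -> hb.
by apply/eqP; rewrite eq_complex /= eqxx /=; apply/eqP; lra.
Qed.

Lemma cabs_ip_le x y : cabs (ip x y) <= N x * N y.
Proof.
(* Scaling x by the conjugate of <x, y> makes the product real, equal to |<x, y>|^2. *)
have := rdot_le hH (conjc (ip x y) *: x) y.
rewrite normCZ /re_ip ipZl// mulrC -abs2E /= -cabsE.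
have -> : cabs (conjc (ip x y)) = cabs (ip x y).
  by rewrite /cabs /abs2; case: (ip x y) => a b /=; rewrite sqrrN.
have [->|c0] := eqVneq (cabs (ip x y)) 0.
  by rewrite mulr_ge0 ?(norm_ge0 ip).
by rewrite expr2 -mulrA ler_pM2l// lt0r c0 cabs_ge0.
Qed.

Lemma hclosed_ip0 x : hclosed [set y | ip x y = 0].
Proof.
move=> y hy /=.
have c0 : cabs (ip x y) <= 0.
  apply: (le0_small (norm_ge0 ip x)) => eps /hy [z [/= xz yz]].
  have -> : ip x y = ip x (y - z).
    by rewrite addrC -scaleN1r ip_linear_r xz mulr0 add0r.
  apply: le_trans (cabs_ip_le _ _) _; rewrite mulrC.
  by rewrite ler_wpM2r ?(norm_ge0 ip)// ltW.
have : abs2 (ip x y) = 0.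
  have -> : 0 = 0 ^+ 2 :> R by rewrite expr0n.
  rewrite -cabsE; congr (_ ^+ 2); apply/eqP.
  by rewrite eq_le c0 cabs_ge0.
move=> /(congr1 (real_complex R)); rewrite abs2E => /eqP.
by rewrite mulf_eq0 conjc_eq0 orbb => /eqP.
Qed.

Lemma csubspace_nullspace T : bounded_op ip T -> csubspace (nullspace T).
Proof.
move=> hT; split; first exact: (op0 hT).
by move=> a x y /= hx hy; rewrite /nullspace /= (op_linear hT) hx hy scaler0 addr0.
Qed.

Lemma hclosed_nullspace T : bounded_op ip T -> hclosed (nullspace T).
Proof.
move=> hT x hx; have [M [M0 hM]] := op_bound hT.
apply: (norm_eq0 hH); apply/eqP; rewrite eq_le (norm_ge0 ip) andbT.
apply: (le0_small (ltW M0)) => eps /hx [y [/= Ty xy]].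
have -> : T x = T (x - y) by rewrite (opB hT) Ty subr0.
by apply: le_trans (hM _) _; rewrite mulrC ler_wpM2r// ltW.
Qed.

Lemma span_le (S P : set V) : csubspace P -> S `<=` P -> span S `<=` P.
Proof.
move=> [P0 hP] SP _ [s [a [hs ->]]].
elim/big_ind: _ => [//|x y Px Py|k _].
  by rewrite -[x]scale1r; exact: hP.
by rewrite -[_ *: _]addr0; apply: hP => //; apply/SP/hs.
Qed.

Lemma span_incl (S : set V) : S `<=` span S.
Proof.
move=> x Sx; exists [:: x], [:: 1]; split; first by case.
by rewrite big_ord1 /= scale1r.
Qed.

Lemma csubspace_span (S : set V) : csubspace (span S).
Proof.
split; first by exists [::], [::]; split => //; rewrite big_ord0.
move=> c _ _ [s [a [hs ->]]] [s' [a' [hs' ->]]].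
(* The coefficients are tabulated, as [a] need not have the length of [s] and a concatenation could
   be misaligned. *)
exists (s ++ s'), (mkseq (fun k => if (k < size s)%N then c * a`_k
                                   else a'`_(k - size s)) (size s + size s')).
split=> [k|].
  rewrite size_cat nth_cat => hk; case: ltnP => ks; first exact: hs.
  by apply: hs'; rewrite ltn_subLR.
rewrite size_cat big_split_ord /= scaler_sumr; congr (_ + _).
  apply: eq_bigr => k _; rewrite scalerA nth_cat nth_mkseq /=.
    by rewrite ltn_ord.
  by rewrite ltn_addr.
apply: eq_bigr => k _; rewrite nth_cat nth_mkseq ?ltn_add2l//.
by rewrite ltnNge leq_addr /= addKn.
Qed.

Lemma span_sub_cspan (S : set V) : span S `<=` cspan S.
Proof. by move=> x Sx eps e0; exists x; rewrite subrr norm0. Qed.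

Lemma csubspace_cspan (S : set V) : csubspace (cspan S).
Proof.
have [s0 hs] := csubspace_span S.
split; first exact: span_sub_cspan.
move=> a x y hx hy eps e0.
have e1 : 0 < eps / 2 / (cabs a + 1).
  by rewrite !divr_gt0//; have := cabs_ge0 a; lra.
have e2 : 0 < eps / 2 by lra.
have [x' [Sx xx]] := hx _ e1; have [y' [Sy yy]] := hy _ e2.
exists (a *: x' + y'); split; first exact: hs.
rewrite opprD addrACA -scalerBr; apply: le_lt_trans (normD hH _ _) _.
rewrite [eps]splitr ler_ltD// normCZ.
rewrite ltr_pdivlMr in xx; last by have := cabs_ge0 a; lra.
apply: le_trans (ltW xx); rewrite mulrC ler_wpM2l ?(norm_ge0 ip)//; lra.
Qed.

Lemma hclosed_cspan (S : set V) : hclosed (cspan S).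
Proof.
move=> x hx eps e0; have e2 : 0 < eps / 2 by lra.
have [y [hy xy]] := hx _ e2; have [z [hz yz]] := hy _ e2.
exists z; split => //; apply: le_lt_trans (normB_le hH _ y _) _.
by rewrite [eps]splitr ltrD.
Qed.

Lemma cspan_le (S P : set V) : csubspace P -> hclosed P -> S `<=` P ->
  cspan S `<=` P.
Proof.
move=> sP cP SP x hx; apply: cP => eps /hx [y [hy xy]].
by exists y; split => //; exact: (span_le sP SP).
Qed.

Lemma hclosed_fixed Q : bounded_op ip Q -> hclosed [set x | Q x = x].
Proof.
move=> hQ x hx; have [M [M0 hM]] := op_bound hQ.
apply/eqP; rewrite -subr_eq0; apply/eqP; apply: (norm_eq0 hH).
apply/eqP; rewrite eq_le (norm_ge0 ip) andbT.
have M1 : 0 <= M + 1 by lra.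
apply: (le0_small M1) => eps /hx [y [/= Qy xy]].
have -> : Q x - x = Q (x - y) - (x - y) by rewrite (opB hQ) Qy opprB addrA subrK.
apply: le_trans (normD hH _ _) _; rewrite normN// mulrDr mulr1.
apply: lerD; last exact: ltW.
by apply: le_trans (hM _) _; rewrite mulrC ler_wpM2r// ltW.
Qed.

(** Q x is the unique p in P with x - p orthogonal to P; uniqueness yields linearity and the values
    on P and on its complement, and |Q x|^2 = <x, Q x> yields the bound 1. *)
Lemma proj_op P : csubspace P -> hclosed P -> exists Q,
  [/\ bounded_op ip Q, forall x, P (Q x),
      forall x, P x -> Q x = x,
      forall x, (forall y, P y -> rdot x y = 0) -> Q x = 0 &
      forall x y, ip (Q x) y = ip x (Q y)].
Proof.
move=> sP cP; have rP := csubspaceW sP; have [P0 hP] := sP.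
have [Q hQ] := choice (fun x => ortho_proj hH x rP cP).
have PQ x : P (Q x) by case: (hQ x).
have QP x y : P y -> rdot (x - Q x) y = 0 by case: (hQ x) => _; apply.
have uniq x p : P p -> (forall y, P y -> rdot (x - p) y = 0) -> Q x = p.
  move=> Pp xp; apply/eqP; rewrite -subr_eq0; apply/eqP; apply: (rdot_eq0 hH).
  have Pd : P (Q x - p) by exact: rsubB.
  have := xp _ Pd; have := QP x _ Pd; rewrite !rdotBl//; lra.
exists Q; split => //.
- split.
    move=> a x y; apply: uniq; first exact: hP.
    (* [rdotJl] moves the complex scalar onto the test vector, which remains in P. *)
    move=> z Pz; rewrite opprD addrACA -scalerBr rdotDl// rdotJl// !QP ?addr0//.
    by rewrite -[_ *: z]addr0; exact: hP.
  exists 1 => x; rewrite mul1r.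
  have [->|/eqP/(norm_gt0 hH) y0] := eqVneq (Q x) 0.
    by rewrite norm0// (norm_ge0 ip).
  rewrite -(ler_pM2r y0) -expr2 normE//; apply: le_trans (rdot_le hH x (Q x)).
  by have := QP x _ (PQ x); rewrite rdotBl//; lra.
- by move=> x Px; apply: uniq => // y _; rewrite subrr rdot0l.
- by move=> x hx; apply: uniq => // y Py; rewrite subr0 hx.
- have QPc x y : P y -> ip (Q x) y = ip x y.
    move=> Py; have := csubspace_rdot0 sP (QP x) Py.
    by rewrite ipDl// -scaleN1r ipZl// mulN1r => /eqP; rewrite subr_eq0 => /eqP.
  move=> x y; rewrite -(QPc x (Q y))// (ip_conj hH y (Q x)) -(QPc y (Q x))//.
  by rewrite -(ip_conj hH).
Qed.

(** * Diagonal projections and index sets *)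

Section Basis.
Variable e : nat -> V.
Hypothesis he : orthonormal_basis ip e.

Lemma basis_neq0 n : e n <> 0.
Proof.
move=> e0; have := he.1 n n; rewrite eqxx e0 ip0l//.
by move=> /eqP; rewrite eq_sym oner_eq0.
Qed.

(** Idempotence forces each eigenvalue to be 0 or 1, and J collects the indices of the e_n that Q
    fixes. Density of the finite combinations of the basis gives one inclusion, closedness of the
    fixed space the other. *)
Lemma diag_proj_range Q : diag_proj ip e Q ->
  exists J, range Q = cspan (e @` J).
Proof.
move=> [hQ [Qd [QQ Qs]]]; exists [set n | Q (e n) = e n].
have Qe n : Q (e n) = e n \/ Q (e n) = 0.
  have [d hd] := Qd n; have := QQ (e n).
  rewrite hd (opZ hQ) hd scalerA => /eqP.
  rewrite -subr_eq0 -scalerBl scaler_eq0 => /orP[|/eqP/basis_neq0//].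
  rewrite -[X in _ - X]mulr1 -mulrBr mulf_eq0 => /orP[/eqP->|].
    by right; rewrite scale0r.
  by rewrite subr_eq0 => /eqP ->; left; rewrite scale1r.
have Qfix x : range Q x <-> Q x = x.
  by split=> [[y _ <-]|<-]; [exact: QQ|exists x].
apply/seteqP; split=> x.
  move=> [z _ <-] eps e0; have [M [M0 hM]] := op_bound hQ.
  have [y [hy zy]] : exists y, span (range e) y /\ N (z - y) < eps / M.
    have : cspan (range e) z by rewrite he.2.
    by apply; rewrite divr_gt0.
  exists (Q y); split; last first.
    rewrite -(opB hQ); apply: le_lt_trans (hM _) _.
    by rewrite mulrC -ltr_pdivlMr.
  have [s0 hs] := csubspace_span (e @` [set n | Q (e n) = e n]).
  apply: (span_le (P := [set y | span (e @` [set n | Q (e n) = e n]) (Q y)])) hy.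
    split; first by rewrite /= (op0 hQ).
    by move=> a u v hu hv; rewrite /= (op_linear hQ); exact: hs.
  move=> _ [n _ <-] /=; have [h|->//] := Qe n.
  by rewrite h; apply: span_incl; exists n.
move=> hx; apply/Qfix; move: x hx.
apply: (cspan_le (P := [set x | Q x = x])); last by move=> _ [n ? <-].
  split; first exact: (op0 hQ).
  by move=> a u v /= hu hv; rewrite (op_linear hQ) hu hv.
exact: hclosed_fixed.
Qed.

(** The projection onto H_J is diagonal: it fixes e_n for n in J and kills the other e_n, which are
    orthogonal to H_J. *)
Lemma diag_proj_ex J : exists Q, diag_proj ip e Q /\ range Q = cspan (e @` J).
Proof.
have [Q [hQ PQ Qid Q0 Qs]] :=
  proj_op (csubspace_cspan (e @` J)) (@hclosed_cspan (e @` J)).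
exists Q; split; last first.
  apply/seteqP; split=> [_ [x _ <-]//|x hx]; exists x => //; exact: Qid.
split=> //; split; last by split=> // x; exact: Qid.
move=> n; have [Jn|Jn] := pselect (J n).
  by exists 1; rewrite scale1r; apply: Qid; apply/span_sub_cspan/span_incl; exists n.
exists 0; rewrite scale0r; apply: Q0.
have sub : csubspace [set y | ip (e n) y = 0].
  have i0 : ip (e n) 0 = 0 by rewrite (ip_conj hH) ip0l// raddf0.
  by split=> // a u v /= hu hv; rewrite ip_linear_r hu hv mulr0 addr0.
move=> y hy; rewrite /re_ip.
suff -> : ip (e n) y = 0 by [].
move: y hy; apply: (cspan_le sub); first exact: hclosed_ip0.
by move=> _ [m Jm <-] /=; rewrite he.1; case: eqP => // nm; case: Jn; rewrite nm.
Qed.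

End Basis.
End Spans.

(** * Frame sums as squared norms of projected adjoints *)

Section Frames.
Variables (R : realType) (V : lmodType R[i]) (ip : V -> V -> R[i]).
Hypothesis hH : hilbert_space ip.
Variable e : nat -> V.
Hypothesis he : orthonormal_basis ip e.
Variable T : V -> V.
Hypothesis hT : bounded_op ip T.

Local Notation rdot := (re_ip ip).
Local Notation N := (hnorm ip).
Local Notation hclosed := (hclosed ip).
Local Notation span := (@Defs.span R V).
Local Notation cspan := (cspan ip).
Local Notation frame := (fun n => T (e n)).
Local Notation "r %:c" := (real_complex R r) (at level 2, format "r %:c").

Lemma abs2_ge0 a : 0 <= abs2 a :> R.
Proof. by rewrite addr_ge0 ?sqr_ge0. Qed.

(* The orthogonal projection of T^* x onto the span of the e_k, k < n, k in J. *)
Definition adjoint_trunc (J : set nat) (x : V) (n : nat) : V :=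
  \sum_(0 <= k < n | k \in J) ip x (T (e k)) *: e k.

Lemma ip_adjoint_trunc J x n m : ip (adjoint_trunc J x n) (e m) =
  if (m < n)%N && (m \in J) then ip x (T (e m)) else 0.
Proof.
rewrite /adjoint_trunc ip_suml// big_mkcond/=.
rewrite (eq_bigr (fun k => if k == m then
    (if m \in J then ip x (T (e m)) else 0) else 0)); last first.
  move=> k _; rewrite ipZl// he.1; case: eqP => [->|_].
    by case: ifP => //; rewrite mulr1.
  by case: ifP => //; rewrite mulr0.
rewrite -big_mkcond/= big_nat1_eq.
by case: (m < n)%N.
Qed.

Lemma norm_adjoint_trunc J x n : N (adjoint_trunc J x n) ^+ 2 =
  \sum_(0 <= k < n | k \in J) abs2 (ip x (T (e k))).
Proof.
rewrite normE// /re_ip; apply: (@complexI R).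
rewrite -/(re_ip ip _ _) -ip_self// {1}/adjoint_trunc ip_suml//.
rewrite (raddf_sum (real_complex R)) [LHS]big_nat_cond [RHS]big_nat_cond.
apply: eq_bigr => k /andP[/= kn kJ].
by rewrite ipZl// (ip_conj hH _ (e k)) ip_adjoint_trunc kn kJ abs2E.
Qed.

Lemma rdot_adjoint_trunc J x n : rdot x (T (adjoint_trunc J x n)) =
  N (adjoint_trunc J x n) ^+ 2.
Proof.
rewrite norm_adjoint_trunc rdotC// /re_ip /adjoint_trunc (op_sum hT) ip_suml//.
suff -> : \sum_(0 <= i < n | i \in J) ip (T (ip x (T (e i)) *: e i)) x =
   (\sum_(0 <= k < n | k \in J) abs2 (ip x (T (e k))))%:c by [].
rewrite (raddf_sum (real_complex R)); apply: eq_bigr => k _.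
by rewrite (opZ hT) ipZl// (ip_conj hH x (T (e k))) /= abs2E.
Qed.

Lemma span_adjoint_trunc J x n : span (e @` J) (adjoint_trunc J x n).
Proof.
have [s0 hs] := csubspace_span (e @` J).
rewrite /adjoint_trunc; elim/big_ind: _ => [//|u v hu hv|k kJ].
  by rewrite -[u]scale1r; exact: hs.
rewrite -[_ *: _]addr0; apply: hs => //; apply: span_incl.
by exists k => //; rewrite -in_setE.
Qed.

(** Testing the hypothesis on the truncation a_n gives |a_n|^2 <= s |a_n|, and |a_n|^2 is the n-th
    partial sum. Together with [frame_sum_ge] this identifies the root of the frame sum with the
    norm of the functional Re <x, T w> of w in H_J. *)
Lemma frame_sum_le J x s : 0 <= s ->
  (forall w, cspan (e @` J) w -> rdot x (T w) <= s * N w) ->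
  (frame_sum ip frame J x <= (s ^+ 2)%:E)%E.
Proof.
move=> s0 h; apply: lime_le.
  by apply: is_cvg_nneseries => n _ _; rewrite lee_fin abs2_ge0.
apply: nearW => n; rewrite sumEFin lee_fin -norm_adjoint_trunc.
have := h _ (span_sub_cspan hH (span_adjoint_trunc J x n)).
rewrite rdot_adjoint_trunc.
have := norm_ge0 ip (adjoint_trunc J x n); set a := N _ => a0.
have [->|an0] := eqVneq a 0; first by rewrite expr0n /= sqr_ge0.
rewrite expr2 ler_pM2r ?lt0r ?an0// => h'.
by rewrite -expr2 ler_sqr.
Qed.

(** For y a finite combination of the e_k, k in J, <a_n, y> equals <x, T y> for all large n, so
    |a_n| <= F gives the bound; density and continuity of T extend it to H_J. *)
Lemma frame_sum_ge J x F : 0 <= F ->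
  (frame_sum ip frame J x <= (F ^+ 2)%:E)%E ->
  forall w, cspan (e @` J) w -> rdot x (T w) <= F * N w.
Proof.
move=> F0 hF.
have trunc_le n : N (adjoint_trunc J x n) <= F.
  rewrite -ler_sqr ?nnegrE ?(norm_ge0 ip)// norm_adjoint_trunc -lee_fin -sumEFin.
  apply: le_trans hF; apply: nneseries_lim_ge => k _ _.
  by rewrite lee_fin abs2_ge0.
have exact_span y : span (e @` J) y ->
    exists n0, forall n, (n0 <= n)%N -> ip (adjoint_trunc J x n) y = ip x (T y).
  move: y; apply: span_le.
    split; first by exists 0%N => n _; rewrite (op0 hT) !(ip_conj hH 0) !ip0l.
    move=> a u v [n0 h0] [n1 h1]; exists (maxn n0 n1) => n.
    rewrite geq_max => /andP[/h0 hu /h1 hv].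
    by rewrite (op_linear hT) !(ip_linear_r hH) hu hv.
  move=> _ [k Jk <-]; exists k.+1 => n kn.
  by rewrite ip_adjoint_trunc kn mem_set.
have [M [M0 hM]] := op_bound hT.
move=> w hw; rewrite -subr_le0.
(* Replacing w by y costs F eps in the norm and |x| M eps under T. *)
apply: (le0_small (b := F + N x * M)).
  by rewrite addr_ge0// mulr_ge0 ?(norm_ge0 ip)// ltW.
move=> eps e0; have [y [hy wy]] := hw _ e0.
have [n0 h0] := exact_span _ hy.
have -> : rdot x (T w) = rdot x (T (w - y)) + rdot x (T y).
  by rewrite (opB hT) rdotBr// subrK.
have h1 : rdot x (T y) <= F * N y.
  rewrite /re_ip -(h0 n0 (leqnn _)); apply: le_trans (rdot_le hH _ _) _.
  by rewrite ler_wpM2r ?(norm_ge0 ip).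
have h2 : rdot x (T (w - y)) <= N x * M * eps.
  apply: le_trans (rdot_le hH _ _) _; rewrite -mulrA ler_wpM2l ?(norm_ge0 ip)//.
  by apply: le_trans (hM _) _; rewrite ler_wpM2l ?ltW.
have h3 : F * N y <= F * (N w + eps).
  apply: ler_wpM2l => //; have -> : y = w + (y - w) by rewrite addrC subrK.
  apply: le_trans (normD hH _ _) _; rewrite lerD2l normBC//.
  exact: ltW.
by rewrite mulrDr (mulrC eps F) (mulrC eps (N x * M)); rewrite mulrDr in h3; lra.
Qed.

End Frames.

(** * Angles, lower bounds for T and frame bounds *)

Section Angles.
Variables (R : realType) (V : lmodType R[i]) (ip : V -> V -> R[i]).
Hypothesis hH : hilbert_space ip.
Variable e : nat -> V.
Hypothesis he : orthonormal_basis ip e.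
Variable T : V -> V.
Hypothesis hT : bounded_op ip T.

Local Notation rdot := (re_ip ip).
Local Notation N := (hnorm ip).
Local Notation hclosed := (hclosed ip).
Local Notation span := (@Defs.span R V).
Local Notation cspan := (cspan ip).
Local Notation frame := (fun n => T (e n)).
Local Notation "r %:c" := (real_complex R r) (at level 2, format "r %:c").

Lemma cabs_ip_le_cangle (M L : set V) x y :
  ominus ip M (M `&` L) x -> ominus ip L (M `&` L) y -> N x = 1 -> N y = 1 ->
  cabs (ip x y) <= cangle ip M L.
Proof.
move=> hx hy x1 y1; apply: ub_le_sup; last by exists x, y.
exists 1 => _ [x' [y' [_ [_ [x'1 [y'1 ->]]]]]].
by apply: le_trans (cabs_ip_le hH _ _) _; rewrite x'1 y'1 mulr1.
Qed.

Lemma cangle_le1 (M L : set V) : cangle ip M L <= 1.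
Proof.
apply: sup_le_nneg => // _ [x [y [_ [_ [x1 [y1 ->]]]]]].
by apply: le_trans (cabs_ip_le hH _ _) _; rewrite x1 y1 mulr1.
Qed.

Lemma cangle_null_le (H : set V) (g M : R) : 0 < g -> 0 < M ->
    (forall x, N (T x) <= M * N x) ->
    (forall y, H y -> (forall w, H w -> T w = 0 -> rdot y w = 0) ->
       g * N y <= N (T y)) ->
  cangle ip (nullspace T) H <= Num.sqrt (1 - (g / M) ^+ 2).
Proof.
move=> g0 M0 hM below; apply: sup_le_nneg; first exact: sqrtr_ge0.
move=> _ [x [y [[Tx _] [[Hy oy] [x1 [y1 ->]]]]]].
have h1 : g <= M * N (y - ip y x *: x).
  apply: le_trans (hM _); rewrite (opB hT) (opZ hT) Tx scaler0 subr0.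
  rewrite -[g]mulr1 -y1; apply: below => // w Hw Tw.
  by rewrite /re_ip oy.
have eN : N (y - ip y x *: x) ^+ 2 = 1 - abs2 (ip x y).
  rewrite normB2// normCZ// x1 y1 mulr1 cabsE rdotC// /re_ip ipZl//.
  rewrite (ip_conj hH y x) -abs2E.
  have -> : abs2 (conjc (ip y x)) = abs2 (ip y x).
    by rewrite /abs2; case: (ip y x) => a b /=; rewrite sqrrN.
  rewrite /= expr1n; ring.
rewrite /cabs ler_wsqrtr// lerBrDr -lerBrDl -eN ler_sqr ?nnegrE ?(norm_ge0 ip)//.
  by rewrite ler_pdivrMr// mulrC.
by rewrite divr_ge0// ltW.
Qed.

Lemma hclosed_preimage (P : set V) : hclosed P -> hclosed [set x | P (T x)].
Proof.
move=> cP x hx /=; have [M [M0 hM]] := op_bound hT.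
apply: cP => eps e0; have [y [Py xy]] := hx _ (divr_gt0 e0 M0).
exists (T y); split=> //; rewrite -(opB hT); apply: le_lt_trans (hM _) _.
by rewrite mulrC -ltr_pdivlMr.
Qed.

Lemma op_cspan J w : cspan (e @` J) w -> cspan (frame @` J) (T w).
Proof.
have [s0 hs] := csubspace_cspan hH (frame @` J); move: w.
apply: (cspan_le (P := [set w | cspan (frame @` J) (T w)])).
- split; first by rewrite /= (op0 hT).
  by move=> a u v /= hu hv; rewrite (op_linear hT); exact: hs.
- by apply: hclosed_preimage; exact: hclosed_cspan.
- by move=> _ [n Jn <-]; apply/(span_sub_cspan hH)/span_incl; exists n.
Qed.

Lemma span_image J z : span (frame @` J) z ->
  exists w, span (e @` J) w /\ T w = z.
Proof.
have [s0 hs] := csubspace_span (e @` J); move: z.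
apply: (span_le (P := [set z | exists w, span (e @` J) w /\ T w = z])).
  split; first by exists 0; rewrite (op0 hT).
  move=> a _ _ [u [hu <-]] [v [hv <-]]; exists (a *: u + v).
  by rewrite (op_linear hT); split => //; exact: hs.
by move=> _ [n Jn <-]; exists (e n); split => //; apply: span_incl; exists n.
Qed.

(** This is [op_bounded_below] for H_J and the closed span of the T e_n, n in J: through
    [frame_sum_le] the lower frame bound becomes the required lower bound on the projected
    adjoint. *)
Lemma frame_op_bounded_below J (g : R) : 0 < g ->
    (forall x, cspan (frame @` J) x ->
      ((g ^+ 2 * N x ^+ 2)%:E <= frame_sum ip frame J x)%E) ->
  forall y, cspan (e @` J) y ->
    (forall w, cspan (e @` J) w -> T w = 0 -> rdot y w = 0) ->
    g * N y <= N (T y).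
Proof.
move=> g0 lower; apply: (op_bounded_below hH hT (K := cspan (frame @` J))) => //.
- exact/csubspaceW/csubspace_cspan.
- exact: hclosed_cspan.
- exact/csubspaceW/csubspace_cspan.
- exact: hclosed_cspan.
- exact: op_cspan.
move=> x s Kx s0 hs.
have := le_trans (lower _ Kx) (frame_sum_le hH he hT s0 hs).
by rewrite lee_fin -exprMn ler_sqr// nnegrE mulr_ge0 ?(norm_ge0 ip)// ltW.
Qed.

(** Let p be the projection of y onto N(T). The angle bound gives |p|^2 = <p, y> <= c |p| |y|, so |y
    - p|^2 = |y|^2 - |p|^2 >= (1 - c^2) |y|^2; moreover T y = T (y - p), and y - p is orthogonal to
    N(T). *)
Lemma angle_op_bounded_below (H : set V) (g c : R) :
    csubspace H -> 0 < g -> 0 <= c < 1 -> cangle ip (nullspace T) H <= c ->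
    (forall y, (forall w, T w = 0 -> rdot y w = 0) -> g * N y <= N (T y)) ->
  forall y, H y -> (forall w, H w -> T w = 0 -> rdot y w = 0) ->
    g * Num.sqrt (1 - c ^+ 2) * N y <= N (T y).
Proof.
move=> sH g0 /andP[c0 c1] hc below y Hy oy.
have sN := csubspace_nullspace hT; have cN := hclosed_nullspace hH hT.
have sI := csubspaceI sN sH.
have [p [Np op]] := ortho_proj hH y (csubspaceW sN) cN.
have pp : rdot p y = N p ^+ 2.
  by have := op _ Np; rewrite rdotBl// normE// (rdotC hH y); lra.
have hp : N p <= c * N y.
  have [->|/eqP/(norm_gt0 hH) p0] := eqVneq p 0.
    by rewrite norm0// mulr_ge0// (norm_ge0 ip).
  have y0 : 0 < N y.
    apply: norm_gt0 => // y0; move: pp; rewrite y0 rdot0r// => /esym/eqP.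
    by rewrite sqrf_eq0 gt_eqF.
  have ox : ominus ip (nullspace T) (nullspace T `&` H) ((N p)^-1%:c *: p).
    split; first exact/(rsubZ _ (csubspaceW sN)).
    move=> z Iz; rewrite ipZl// (csubspace_rdot0 hH sI _ Iz) ?mulr0//.
    (* Both y and y - p are orthogonal to the intersection, hence so is p. *)
    move=> w [Nw Hw]; have := op _ Nw; rewrite rdotBl// oy//; lra.
  have oy' : ominus ip H (nullspace T `&` H) ((N y)^-1%:c *: y).
    split; first exact/(rsubZ _ (csubspaceW sH)).
    move=> z Iz; rewrite ipZl// (csubspace_rdot0 hH sI _ Iz) ?mulr0//.
    by move=> w [Nw Hw]; exact: oy.
  have unit v : 0 < N v -> N ((N v)^-1%:c *: v) = 1.
    by move=> v0; rewrite normZ// gtr0_norm ?invr_gt0// mulVf// gt_eqF.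
  have := le_trans (cabs_ip_le_cangle ox oy' (unit _ p0) (unit _ y0)) hc.
  move=> /(le_trans (_ : re_ip ip _ _ <= _)) h.
  have : rdot ((N p)^-1%:c *: p) ((N y)^-1%:c *: y) <= c.
    apply: h; rewrite /re_ip /cabs /abs2.
    case: (ip _ _) => a b /=; apply: le_trans (ler_norm a) _.
    by rewrite -sqrtr_sqr ler_wsqrtr// lerDl sqr_ge0.
  rewrite rdotZl// rdotZr// pp.
  have -> : (N p)^-1 * ((N y)^-1 * N p ^+ 2) = N p / N y.
    by field; rewrite !gt_eqF.
  by rewrite ler_pdivrMr.
have hd : Num.sqrt (1 - c ^+ 2) * N y <= N (y - p).
  have k0 : 0 <= 1 - c ^+ 2 by rewrite subr_ge0 expr_le1// ltW.
  rewrite -ler_sqr ?nnegrE ?mulr_ge0 ?sqrtr_ge0 ?(norm_ge0 ip)//.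
  rewrite exprMn sqr_sqrtr// normB2// (rdotC hH y) pp.
  have : N p ^+ 2 <= c ^+ 2 * N y ^+ 2.
    by rewrite -exprMn ler_sqr ?nnegrE ?mulr_ge0 ?(norm_ge0 ip).
  by rewrite mulrBl; lra.
have -> : T y = T (y - p) by rewrite (opB hT) [T p]Np subr0.
rewrite -mulrA; apply: le_trans (below _ op).
by rewrite ler_wpM2l// ltW.
Qed.

Lemma frame_sum_upper (M : R) J x : 0 < M -> (forall x, N (T x) <= M * N x) ->
  (frame_sum ip frame J x <= (M ^+ 2 * N x ^+ 2)%:E)%E.
Proof.
move=> M0 hM; rewrite -exprMn; apply: frame_sum_le => //.
  by rewrite mulr_ge0 ?(norm_ge0 ip)// ltW.
move=> w _; apply: le_trans (rdot_le hH _ _) _.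
by rewrite (mulrC M) -mulrA ler_wpM2l ?(norm_ge0 ip).
Qed.

(** With f the root of the frame sum, each w in H_J orthogonal to the kernel of T in H_J satisfies d
    <x, T w> <= d f |w| <= f |T w|. Letting T w tend to x gives d |x|^2 <= f |x|. *)
Lemma frame_sum_lower J (d : R) : 0 < d ->
    (forall y, cspan (e @` J) y ->
      (forall w, cspan (e @` J) w -> T w = 0 -> rdot y w = 0) ->
      d * N y <= N (T y)) ->
  forall x, cspan (frame @` J) x ->
    ((d ^+ 2 * N x ^+ 2)%:E <= frame_sum ip frame J x)%E.
Proof.
move=> d0 below x Kx; have [M [M0 hM]] := op_bound hT.
have F_ge0 : (0 <= frame_sum ip frame J x)%E.
  by apply: nneseries_ge0 => n _ _; rewrite lee_fin abs2_ge0.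
have := frame_sum_upper J x M0 hM.
(* The upper bound excludes an infinite sum. *)
case EF : (frame_sum ip frame J x) F_ge0 => [F| |] //=; rewrite !lee_fin => F0 _.
rewrite -exprMn -[F]sqr_sqrtr// ler_sqr ?nnegrE ?sqrtr_ge0//; last first.
  by rewrite mulr_ge0 ?(norm_ge0 ip)// ltW.
set f := Num.sqrt F; have f0 : 0 <= f by exact: sqrtr_ge0.
have hf w : cspan (e @` J) w -> rdot x (T w) <= f * N w.
  apply: (frame_sum_ge hH he hT) => //.
  by rewrite EF lee_fin sqr_sqrtr.
have [->|/eqP/(norm_gt0 hH) x0] := eqVneq x 0; first by rewrite norm0// mulr0.
rewrite -(ler_pM2r x0) -mulrA -expr2 -subr_le0.
have sHJ := csubspace_cspan hH (e @` J); have cHJ := hclosed_cspan hH (S := e @` J).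
have sI := csubspaceW (csubspaceI (csubspace_nullspace hT) sHJ).
have cI := hclosedI (hclosed_nullspace hH hT) cHJ.
apply: (le0_small (b := f + d * N x)).
  by rewrite addr_ge0// mulr_ge0// ltW.
move=> eps e0; have [z [/span_image [w [hw Tw]] xz]] := Kx _ e0.
(* Removing the kernel part p keeps the image z; w - p may leave the span but stays in H_J. *)
have [p [[Tp Hp] op]] := ortho_proj hH w sI cI.
have Hw' : cspan (e @` J) (w - p).
  exact: (rsubB (csubspaceW sHJ) (span_sub_cspan hH hw)).
have Tw' : T (w - p) = z by rewrite (opB hT) [T p]Tp subr0.
have h1 : d * N (w - p) <= N z.
  by rewrite -Tw'; apply: below => // v Hv Tv; apply: op.
have h2 : d * rdot x z <= f * N z.
  rewrite -Tw'; apply: le_trans (ler_wpM2l (ltW d0) (hf _ Hw')) _.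
  by rewrite mulrCA ler_wpM2l// Tw'.
have h3 : f * N z <= f * (N x + eps).
  apply: ler_wpM2l => //; have -> : z = x + (z - x) by rewrite addrC subrK.
  apply: le_trans (normD hH _ _) _; rewrite lerD2l normBC//.
  exact: ltW.
have h4 : d * rdot x (x - z) <= d * (N x * eps).
  rewrite ler_pM2l//; apply: le_trans (rdot_le hH _ _) _.
  by rewrite ler_pM2l// ltW.
rewrite normE//; rewrite rdotBr// in h4.
rewrite mulrDr in h3; move: h2 h3 h4; rewrite (mulrBr d).
by rewrite mulrDr (mulrC eps f) (mulrC eps) (mulrA d); lra.
Qed.

(** * The two implications *)

Lemma riesz_frame_compatible :
  riesz_frame ip frame -> compatible ip e (nullspace T).
Proof.
move=> [_ [C [C0 hC]]]; have [M [M0 hM]] := op_bound hT.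
have g0 : 0 < Num.sqrt C by rewrite sqrtr_gt0.
(* Frame constants are squares of operator bounds, hence the root of C; this bound is below 1 and
   the same for every Q. *)
apply: (@le_lt_trans _ _ (Num.sqrt (1 - (Num.sqrt C / M) ^+ 2))); last first.
  rewrite -[ltRHS]sqrtr1 ltr_sqrt// gtrBl.
  by rewrite exprn_gt0// divr_gt0.
apply: sup_le_nneg; first exact: sqrtr_ge0.
move=> _ [Q [dQ ->]]; have [J ->] := diag_proj_range hH he dQ.
apply: cangle_null_le => //; apply: frame_op_bounded_below => // x Kx.
have [A [B [CA [_ [_ /(_ _ Kx) [hA _]]]]]] := hC J.
apply: le_trans hA; rewrite lee_fin sqr_sqrtr ?(ltW C0)//.
by rewrite ler_wpM2r ?sqr_ge0.
Qed.

Lemma compatible_riesz_frame : (forall y, exists x, T x = y) ->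
  compatible ip e (nullspace T) -> riesz_frame ip frame.
Proof.
move=> surj; rewrite /compatible; set c0 := sup _ => c01.
have [M [M0 hM]] := op_bound hT.
have [g [g0 hg]] := surj_adjoint_below hH hT surj.
have below y : (forall w, T w = 0 -> rdot y w = 0) -> g * N y <= N (T y).
  (* On the whole space, the lower bound for the adjoint passes to T on the complement of N(T). *)
  move=> oy; apply: (op_bounded_below hH hT (H := setT) (K := setT)) => //.
  - by move=> x s _ s0 hx; apply: hg => // w; exact: hx.
  - by move=> w _; exact: oy.
(* The maximum supplies the sign that [angle_op_bounded_below] asks for. *)
pose c := Num.max 0 c0.
have c_ge0 : 0 <= c by rewrite le_max lexx.
have c_lt1 : c < 1 by rewrite gt_max ltr01.
pose d := g * Num.sqrt (1 - c ^+ 2).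
have d0 : 0 < d by rewrite mulr_gt0// sqrtr_gt0 subr_gt0 expr_lt1.
have lower J x : cspan (frame @` J) x ->
    ((d ^+ 2 * N x ^+ 2)%:E <= frame_sum ip frame J x)%E.
  move: x; apply: frame_sum_lower => //.
  apply: angle_op_bounded_below => //; first exact: csubspace_cspan.
    by rewrite c_ge0.
  have [Q [dQ <-]] := diag_proj_ex hH he J.
  apply: (@le_trans _ _ c0); last by rewrite le_max lexx orbT.
  (* Comparing a member with [sup] requires the set to be bounded above; all angles are at most
     1. *)
  apply: ub_le_sup; last by exists Q.
  by exists 1 => _ [Q' [_ ->]]; exact: cangle_le1.
have Rframe J : frame_of ip (cspan (frame @` J)) frame J (d ^+ 2) (M ^+ 2).
  split; first exact: exprn_gt0.
  split; first exact: exprn_gt0.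
  by move=> x Kx; split; [exact: lower|exact: frame_sum_upper].
split.
  (* By surjectivity the closed span of all T e_n is the whole space. *)
  exists (d ^+ 2), (M ^+ 2); have [h1 [h2 h3]] := Rframe setT.
  split => //; split => // x _; apply: h3; have [w <-] := surj x.
  by apply: op_cspan; rewrite he.2.
exists (d ^+ 2); split; first exact: exprn_gt0.
by move=> J; exists (d ^+ 2), (M ^+ 2).
Qed.

End Angles.

Theorem theorem5p1 (R : realType) (V : lmodType R[i]) (ip : V -> V -> R[i])
  (hH : hilbert_space ip) (e : nat -> V) (he : orthonormal_basis ip e)
  (T : V -> V) (hT : bounded_op ip T) (hsurj : forall y : V, exists x, T x = y) :
  riesz_frame ip (fun n => T (e n)) <-> compatible ip e (nullspace T).
Proof.
split; first exact: riesz_frame_compatible.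
exact: compatible_riesz_frame.
Qed.
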